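(* Let $m\geq 3$ and $n\geq 1$ be integers and let $W_{n,m}=E_n+C_m$. Then $$\alpha(F_2(W_{n,m}))=\left\lfloor\frac{m}{2}\left\lfloor\frac{m}{2}\right\rfloor\right\rfloor+\binom{n}{2},$$ except when $(m,n)\in\{(3,1),(3,2)\}$.
   Context: $E_n$ is the edgeless graph on $n$ vertices and $C_m$ the cycle on $m$ vertices. The join $G_1+G_2$ of disjoint graphs has vertex set $V(G_1)\cup V(G_2)$ and edge set $E(G_1)\cup E(G_2)\cup\{uv: u\in V(G_1), v\in V(G_2)\}$. For a finite simple graph $G$, the $2$-token graph $F_2(G)$ has as vertices the $2$-element subsets of $V(G)$, two adjacent iff their symmetric difference is an edge of $G$. $\alpha$ is the independence number, and $\binom{j}{k}=0$ when $j<k$. *)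

(* Defs.v *)
From mathcomp Require Import all_boot.

Set Implicit Arguments.
Unset Strict Implicit.
Unset Printing Implicit Defensive.

Record sgraph := SGraph {
  svertex :> finType;
  sedge : rel svertex;
  sedge_sym : symmetric sedge;
  sedge_irrefl : irreflexive sedge }.

Arguments sedge {s}.

Definition edge_set (G : sgraph) : {set {set G}} :=
  [set [set p.1; p.2] | p in [set p : G * G | sedge p.1 p.2]].

Definition independent (G : sgraph) (S : {set G}) : bool :=
  [forall x in S, forall y in S, ~~ sedge x y].

Definition independence_number (G : sgraph) : nat :=
  \max_(S : {set G} | independent S) #|S|.

Section Edgeless.
Variable n : nat.

Definition edgeless_rel : rel 'I_n := fun _ _ => false.

Fact edgeless_sym : symmetric edgeless_rel.
Proof. by []. Qed.

Fact edgeless_irrefl : irreflexive edgeless_rel.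
Proof. by []. Qed.

Definition edgeless : sgraph := SGraph edgeless_sym edgeless_irrefl.
End Edgeless.

Section Cycle.
Variable m : nat.

(* The clause i != j only removes the loop that would arise for m = 1; the    *)
(* graph is the cycle C_m for m >= 3.                                         *)
Definition cycle_rel : rel 'I_m := fun i j =>
  (i != j) && ((j == i.+1 %% m :> nat) || (i == j.+1 %% m :> nat)).

Fact cycle_sym : symmetric cycle_rel.
Proof. by move=> i j; rewrite /cycle_rel eq_sym orbC. Qed.

Fact cycle_irrefl : irreflexive cycle_rel.
Proof. by move=> i; rewrite /cycle_rel eqxx. Qed.

Definition cycle_graph : sgraph := SGraph cycle_sym cycle_irrefl.
End Cycle.

Section Join.
Variables G1 G2 : sgraph.

Definition join_rel : rel (G1 + G2)%type := fun u v =>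
  match u, v with
  | inl x, inl y => sedge x y
  | inr x, inr y => sedge x y
  | _, _ => true
  end.

Fact join_sym : symmetric join_rel.
Proof. by move=> [x|x] [y|y] //=; apply: sedge_sym. Qed.

Fact join_irrefl : irreflexive join_rel.
Proof. by move=> [x|x] /=; apply: sedge_irrefl. Qed.

Definition join : sgraph := SGraph join_sym join_irrefl.
End Join.

Section TwoToken.
Variable G : sgraph.

Definition token_vertex : finType := {A : {set G} | #|A| == 2}.

Definition token_rel : rel token_vertex := fun A B =>
  (val A :\: val B) :|: (val B :\: val A) \in edge_set G.

Fact token_sym : symmetric token_rel.
Proof. by move=> A B; rewrite /token_rel setUC. Qed.

Fact token_irrefl : irreflexive token_rel.
Proof.
move=> A; rewrite /token_rel setDv setU0; apply/imsetP=> -[p _ /setP /(_ p.1)].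
by rewrite !inE eqxx.
Qed.

Definition two_token : sgraph := SGraph token_sym token_irrefl.
End TwoToken.

Definition gen_wheel (n m : nat) : sgraph := join (edgeless n) (cycle_graph m).

(* Main.v *)
Require Import Defs.
From mathcomp Require Import all_boot.
From mathcomp Require Import zify.

(** A set of vertices of F_2(G) is a graph H on V(G), and it is independent
    exactly when every neighbourhood N_H(x) is independent in G; so 2 alpha is
    the largest degree sum of such an H.
    Upper bound for G = E_n + C_m, with k = m/2 rounded down: a neighbourhood
    lies in E_n, or lies in C_m and has at most k elements.  Let Q be the q
    vertices of E_n with an H-neighbour in C_m, S the s vertices of C_m with an
    H-neighbour in E_n, and p = n - q.  The degree sum is at most
    p(p-1) + 2q min(s,k) + (m-s) min(k,m-s-1), which is at most n(n-1) + mk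
    except when m = 2k+1, s = k and p = 0; there two of the k+1 vertices of
    C_m outside S are adjacent in the cycle, so they have no common
    H-neighbour, and this gains enough unless m = 3 and n < 3.
    Lower bound: the complete graph on E_n together with an almost k-regular H
    on C_m whose neighbourhoods are maximum independent sets of the cycle. *)

Set Implicit Arguments.
Unset Strict Implicit.
Unset Printing Implicit Defensive.

(** * Two-element sets and ordered pairs *)

Section PairCount.
Variable T : finType.
Implicit Types (A B : {set T}) (F : {set {set T}}) (r : rel T).

Lemma card_ordered_pairs F : (forall A, A \in F -> #|A| = 2) ->
  #|[set p : T * T | (p.1 != p.2) && ([set p.1; p.2] \in F)]| = 2 * #|F|.
Proof.
move=> F2.
rewrite -sum1_card (partition_big (fun p => [set p.1; p.2]) (mem F)) /=; last first.
  by move=> p; rewrite inE => /andP[].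
rewrite mulnC -sum_nat_const; apply: eq_bigr => A AF.
have /eqP/cards2P[x [y [xy defA]]] := F2 A AF.
have <- : #|[set (x, y); (y, x)]| = 2 by rewrite cards2 xpair_eqE (negPf xy).
rewrite sum1_card; apply: eq_card => -[u v].
rewrite !inE unfold_in /= inE /= !xpair_eqE.
apply/idP/idP => [/andP[/andP[uv _] /eqP uvA]|].
  have : u \in A by rewrite -uvA !inE eqxx.
  have : v \in A by rewrite -uvA !inE eqxx orbT.
  by rewrite defA !inE => /orP[]/eqP vE /orP[]/eqP uE; subst; rewrite ?eqxx ?orbT // in uv *.
by case/orP=> /andP[/eqP-> /eqP->]; rewrite ?[y == x]eq_sym xy ?[[set y; x]]setUC -defA AF eqxx.
Qed.

(** Both differences have the same size, [2 - #|A :&: B|], and two elements in all, so each of them,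
    and hence the intersection, is a singleton. *)
Lemma setDU_pairP A B : #|A| = 2 -> #|B| = 2 ->
  forall y z, y != z -> (A :\: B) :|: (B :\: A) = [set y; z] ->
  exists x, (A = [set x; y] /\ B = [set x; z]) \/ (A = [set x; z] /\ B = [set x; y]).
Proof.
move=> A2 B2 y z yz D.
have dis : [disjoint A :\: B & B :\: A].
  by rewrite -setI_eq0; apply/eqP/setP => x; rewrite !inE; case: (x \in A); case: (x \in B).
have cD : #|A :\: B| + #|B :\: A| = 2.
  by move: dis; rewrite -leq_card_setU D => /eqP <-; rewrite cards2 yz.
have := cardsID B A; have := cardsID A B; rewrite (setIC B A) A2 B2 => cB cA.
have /eqP/cards1P[x Ix] : #|A :&: B| = 1 by lia.
have /eqP/cards1P[y' Iy] : #|A :\: B| = 1 by lia.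
have /eqP/cards1P[z' Iz] : #|B :\: A| = 1 by lia.
have EA : A = [set x; y'] by rewrite -(setID A B) Ix Iy.
have EB : B = [set x; z'] by rewrite -(setID B A) setIC Ix Iz.
exists x; move: D; rewrite Iy Iz => D.
have y'z' : y' != z'.
  by have := cards2 y' z'; rewrite D cards2 yz; case: eqP.
have : y' \in [set y; z] by rewrite -D !inE eqxx.
have : z' \in [set y; z] by rewrite -D !inE eqxx orbT.
rewrite !inE => /orP[]/eqP zE /orP[]/eqP yE; subst; rewrite ?eqxx // in y'z' *.
  by right.
by left.
Qed.

End PairCount.

(** * Independent sets of tokens as relations *)

Section TokenRelation.
Variable G : sgraph.
Implicit Types (r : rel G).

Definition nbhd_independent r :=
  [/\ symmetric r, irreflexive r
    & forall x y z, r x y -> r x z -> ~~ sedge y z].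

(** This turns adjacency of tokens into a condition on two neighbours of a common vertex [x], the
    form used in [nbhd_independent]. *)
Lemma token_relP (A B : token_vertex G) :
  reflect (exists x y z, [/\ val A = [set x; y], val B = [set x; z],
                             x != y, x != z & sedge y z])
          (token_rel A B).
Proof.
have card_tok (C : token_vertex G) : #|val C| = 2 by apply/eqP; exact: (valP C).
have pair_neq (C : token_vertex G) x y : val C = [set x; y] -> x != y.
  by move=> E; have := card_tok C; rewrite E cards2; case: eqP.
apply: (iffP imsetP) => [[[y z]] | [x [y [z [EA EB xy xz yz]]]]].
  rewrite inE /= => yz D.
  have y_neq_z : y != z by apply: contraTneq yz => ->; rewrite sedge_irrefl.
  have [x [[EA EB]|[EA EB]]] := setDU_pairP (card_tok A) (card_tok B) y_neq_z D.
    by exists x, y, z; split=> //; [apply: pair_neq EA | apply: pair_neq EB].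
  exists x, z, y; split=> //; [apply: pair_neq EA | apply: pair_neq EB|] => //.
  by rewrite sedge_sym.
have y_neq_z : y != z by apply: contraTneq yz => ->; rewrite sedge_irrefl.
exists (y, z); first by rewrite inE.
rewrite EA EB; apply/setP => w; rewrite !inE.
case: (w =P x) => [->|_]; first by rewrite (negPf xy) (negPf xz).
by case: (w =P y) => [->|_]; rewrite ?(negPf y_neq_z) ?andbF ?orbF //= orbF.
Qed.

Lemma nbhd_independent_leq r : nbhd_independent r ->
  #|[set p : G * G | r p.1 p.2]| <= 2 * independence_number (two_token G).
Proof.
move=> [r_sym r_irr r_ind].
pose S := [set A : two_token G | [exists x, exists y, r x y && (val A == [set x; y])]].
have pairS (A : two_token G) x y : A \in S -> val A = [set x; y] -> r x y.
  rewrite inE => /existsP[u /existsP[v /andP[ruv /eqP EA]]] EA'.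
  have uv : u != v by apply: contraTneq ruv => ->; rewrite r_irr.
  have : u \in val A by rewrite EA !inE eqxx.
  have : v \in val A by rewrite EA !inE eqxx orbT.
  rewrite EA' !inE => /orP[]/eqP vE /orP[]/eqP uE; subst; rewrite ?eqxx // in uv *.
  by rewrite r_sym.
have S_ind : independent S.
  apply/forall_inP => A AS; apply/forall_inP => B BS; apply/token_relP.
  move=> [x [y [z [EA EB _ _ yz]]]].
  by have := r_ind x y z (pairS _ _ _ AS EA) (pairS _ _ _ BS EB); rewrite yz.
have leS : #|S| <= independence_number (two_token G).
  exact: (@leq_bigmax_cond _ _ (fun S : {set two_token G} => #|S|)).
apply: leq_trans (_ : 2 * #|S| <= _); last by rewrite leq_mul2l.
rewrite -(card_imset _ (@val_inj _ _ (token_vertex G))) -card_ordered_pairs.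
  apply: subset_leq_card; apply/subsetP => -[x y]; rewrite !inE /= => rxy.
  have xy : x != y by apply: contraTneq rxy => ->; rewrite r_irr.
  rewrite xy /=.
  have c2 : #|[set x; y]| == 2 by rewrite cards2 xy.
  apply/imsetP; exists (Sub [set x; y] c2); last by rewrite SubK.
  by rewrite inE; apply/existsP; exists x; apply/existsP; exists y; rewrite rxy SubK eqxx.
by move=> _ /imsetP[A _ ->]; apply/eqP; exact: (valP A).
Qed.

Lemma nbhd_independent_ex : exists2 r, nbhd_independent r &
  #|[set p : G * G | r p.1 p.2]| = 2 * independence_number (two_token G).
Proof.
have [S S_ind ->] : exists2 S : {set two_token G},
    independent S & independence_number (two_token G) = #|S|.
  (* The maximum is attained only because some independent set exists. *)
  have ind0 : independent (set0 : {set two_token G}).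
    by apply/forall_inP => A; rewrite inE.
  have [|S SI E] := @eq_bigmax_cond _ [pred S : {set two_token G} | independent S] (fun S => #|S|).
    by apply/card_gt0P; exists set0.
  by exists S => //; rewrite /independence_number -E.
pose F := [set val A | A in S].
have F2 A : A \in F -> #|A| = 2.
  by move=> /imsetP[B _ ->]; apply/eqP; exact: (valP B).
exists (fun x y => (x != y) && ([set x; y] \in F)); last first.
  by rewrite card_ordered_pairs // card_imset //; apply: val_inj.
split=> [x y|x|x y z]; rewrite ?eqxx //; first by rewrite eq_sym setUC.
move=> /andP[xy /imsetP[A AS EA]] /andP[xz /imsetP[B BS EB]].
have /forall_inP/(_ A AS)/forall_inP/(_ B BS) := S_ind.
by apply: contra => yz; apply/token_relP; exists x, y, z.
Qed.

End TokenRelation.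

(** * Arithmetic of the upper bound *)

(** The right side minus the left is (q - x)(q - x - 1), a product of consecutive integers. *)
Lemma double_mul_leq q x : 2 * (q * x) <= q * q.-1 + x * x + x.
Proof.
case: q => [|q] //=; have [xq|qx] := leqP x q.
  by rewrite -(subnKC xq); move: (q - x) => e; lia.
by rewrite -(subnKC qx); move: (x - q.+1) => e; lia.
Qed.

(** In the application [a], [b] and [d] count the related ordered pairs inside E_n, from E_n to C_m,
    and inside C_m. The last two hypotheses serve the one case that the other bounds leave open:
    [m = 2 * k + 1], [s = k], [p = 0]. *)
Lemma edge_count_leq m p q s k a b d :
  3 <= m -> k = m %/ 2 -> s <= m -> (s = 0 -> q = 0) ->
  a <= p * p.-1 -> b <= q * s -> b <= q * k ->
  d <= (m - s) * k -> d <= (m - s) * (m - s).-1 ->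
  (m = 2 * k + 1 -> s = k -> 2 <= k -> d <= k.-1 * k.-1 + k.+1) ->
  (m = 3 -> 3 <= p + q) ->
  a + 2 * b + d <= m * k + (p + q) * (p + q).-1.
Proof.
move=> m3 Ek sm s0 Ha Hb1 Hb2 Hd1 Hd2 Hsp H3.
have [q0|q0] := posnP q.
  have b0 : b = 0 by move: Hb1; rewrite q0 mul0n leqn0 => /eqP.
  have : (m - s) * k <= m * k by rewrite leq_mul2r leq_subr orbT.
  subst q; rewrite addn0; lia.
have Epq : (p + q) * (p + q).-1 = p * p.-1 + 2 * (p * q) + q * q.-1.
  case: (p) => [|p']; first by rewrite !add0n.
  by case: (q) q0 => [|q'] // _; rewrite addnS /=; lia.
rewrite Epq.
suff : 2 * b + d <= m * k + 2 * (p * q) + q * q.-1 by lia.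
have [k' Ek'] : exists k', k = k'.+1 by exists k.-1; lia.
have m2k : m = k + k \/ m = k + k + 1 by lia.
clear Ek Epq.
have [sk|sk|sk] := ltngtP s k.
(* The excess [s * s.+1] is at most [s * k], which the bound on [d] saves against [m * k]. *)
- have := double_mul_leq q s.
  have : s * s.+1 <= s * k by rewrite leq_mul2l sk orbT.
  rewrite mulnBl in Hd1. have : s * k <= m * k by rewrite leq_mul2r sm orbT.
  lia.
- have := double_mul_leq q k.
  have : d + (k * k + k) <= m * k.
    case: m2k => m2k.
      have : (m - s) * (m - s).-1 <= k' * k'.-1 by apply: leq_mul; lia.
      have : k' * k'.-1 <= k' * k' by rewrite leq_mul2l leq_pred orbT.
      subst k; rewrite m2k; lia.
    have : (m - s) * (m - s).-1 <= k * k' by apply: leq_mul; lia.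
    subst k; rewrite m2k; lia.
  lia.
- subst s; case: m2k => m2k.
    have ms : m - k = k by lia.
    rewrite ms Ek' /= -Ek' in Hd2.
    have := double_mul_leq q k; subst k; rewrite m2k; lia.
  have ms : m - k = k.+1 by lia.
  have [p0|p0] := posnP p; last first.
    (* Since [2 * (p * q)] absorbs [2 * q], it suffices to bound [2 * (q * k')], where [k'] is
       [k - 1]. *)
    rewrite ms in Hd1.
    have : q <= p * q by rewrite leq_pmull.
    have := double_mul_leq q k'; subst k; rewrite m2k; lia.
  have [k2|k2] := leqP 2 k.
    have := Hsp _ erefl k2; rewrite m2k => /(_ ltac:(lia)).
    have := double_mul_leq q k; subst k; lia.
  have k1 : k = 1 by lia.
  rewrite p0 m2k k1 in H3 Hd1 Hb1 *.
  have := H3 erefl.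
  (* What remains is [2 * q + 2 <= 3 + q * (q - 1)], true from [q = 3] on. *)
  case: (q) Hb1 => [|[|[|q']]] //=; lia.
Qed.

(** * Degree sums *)

Lemma card_rel_sum (T : finType) (r : rel T) :
  #|[set p : T * T | r p.1 p.2]| = \sum_x \sum_y r x y.
Proof.
rewrite -sum1_card big_mkcond pair_bigA; apply: eq_bigr => -[x y] _.
by rewrite inE /=; case: r.
Qed.

Lemma sum_bool_card (T : finType) (P : pred T) : \sum_y P y = #|[set y | P y]|.
Proof.
by rewrite -sum1_card [RHS]big_mkcond; apply: eq_bigr => y _; rewrite inE; case: (P y).
Qed.

Lemma sum_rel_leq (T U : finType) (r : T -> U -> bool) (D : {set T}) b :
  (forall x, x \in D -> #|[set y | r x y]| <= b) ->
  (forall x y, r x y -> x \in D) ->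
  \sum_x \sum_y r x y <= #|D| * b.
Proof.
move=> rb rD; rewrite (bigID (mem D)) /= [X in _ + X]big1 ?addn0 => [|x xD].
  by rewrite -sum_nat_const; apply: leq_sum => x xD; rewrite sum_bool_card rb.
by rewrite big1 // => y _; case: (boolP (r x y)) => // /rD; rewrite (negPf xD).
Qed.

(** The disjoint neighbourhoods of [c] and [c'] contribute at most [#|D|] together; every other
    vertex of [D] has at most [#|D|.-2] neighbours. *)
Lemma sum_rel_leq_disjoint_nbhds (T : finType) (r : rel T) (D : {set T}) c c' :
  symmetric r -> irreflexive r -> (forall x y, r x y -> x \in D) ->
  c \in D -> c' \in D -> c != c' -> (forall x, r c x -> ~~ r c' x) ->
  \sum_x \sum_y r x y <= #|D|.-2 * #|D|.-2 + #|D|.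
Proof.
move=> r_sym r_irr rD cD c'D cc' dis.
have rD' x y : r x y -> y \in D by rewrite r_sym; apply: rD.
rewrite (bigD1 c) //= [X in _ + X](bigD1 c') 1?eq_sym //= addnA addnC !sum_bool_card.
apply: leq_add; last first.
  have I0 : [set y | r c y] :&: [set y | r c' y] = set0.
    apply/setP => y; rewrite !inE; apply/negP => /andP[/dis]; exact: negP.
  rewrite -cardsUI I0 cards0 addn0.
  by apply/subset_leq_card/subsetP => y; rewrite !inE => /orP[]; apply: rD'.
pose E := (D :\ c) :\ c'.
have cE : #|E| = #|D|.-2.
  have := cardsD1 c D; have := cardsD1 c' (D :\ c).
  rewrite !inE eq_sym cc' c'D cD /E; lia.
rewrite -[X in X * _]cE -sum_nat_const (bigID (mem D)) /=.
rewrite [X in _ + X]big1 ?addn0 => [|x /andP[_ xD]]; last first.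
  by rewrite big1 // => y _; case: (boolP (r x y)) => // /rD; rewrite (negPf xD).
rewrite (eq_bigl (mem E)) => [|x]; last by rewrite !inE andbA [(x != c') && _]andbC.
apply: leq_sum => x; rewrite !inE => /and3P[xc' xc xD]; rewrite sum_bool_card.
(* x is not joined to both c and c', so it misses itself and one more vertex *)
have [d [dD dx rdx]] : exists d, [/\ d \in D, d != x & ~~ r x d].
  case: (boolP (r c x)) => [/dis rx|rx]; [exists c'|exists c];
  by split; rewrite // 1?eq_sym // r_sym.
have <- : #|(D :\ x) :\ d| = #|D|.-2.
  have := cardsD1 x D; have := cardsD1 d (D :\ x).
  rewrite !inE dx dD xD; lia.
apply/subset_leq_card/subsetP => y; rewrite !inE => rxy.
rewrite (rD' _ _ rxy) andbT; apply/andP; split.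
  by apply: contraNneq rdx => <-.
by apply: contraTneq rxy => ->; rewrite r_irr.
Qed.

(** * Upper bound on the degree sum *)

(** [I] and its image under the cyclic successor are disjoint and equally large. *)
Lemma independent_cycle_card m (I : {set 'I_m}) : 2 <= m ->
  (forall x y, x \in I -> y \in I -> ~~ cycle_rel x y) -> #|I| <= m %/ 2.
Proof.
move=> m2 Iind.
have dis : [disjoint I & [set ordS x | x in I]].
  rewrite disjoint_sym disjoints_subset; apply/subsetP => _ /imsetP[x xI ->].
  rewrite inE; apply/negP => SxI; have := Iind _ _ xI SxI.
  rewrite /cycle_rel /= eqxx andbT negbK => /eqP/(congr1 val) /= E.
  have [xm|xm] := ltnP x.+1 m; first by move: E; rewrite modn_small //; lia.
  have Ex : x.+1 = m by have := ltn_ord x; lia.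
  by move: E; rewrite Ex modnn; lia.
have : #|I :|: [set ordS x | x in I]| <= m by rewrite -[X in _ <= X]card_ord max_card.
move: dis; rewrite -leq_card_setU => /eqP ->.
rewrite card_imset; last exact: ordS_inj.
by rewrite addnn leq_divRL // muln2.
Qed.

Lemma gen_wheel_pairs_leq m n (r : rel (gen_wheel n m)) :
  3 <= m -> (m = 3 -> 3 <= n) -> nbhd_independent r ->
  #|[set p | r p.1 p.2]| <= m * (m %/ 2) + n * n.-1.
Proof.
move=> m3 n3 [r_sym r_irr r_ind].
(* A neighbourhood meeting both sides would contain an edge of the join. *)
have rmix x (u : 'I_n) (c : 'I_m) : r x (inl u) -> r x (inr c) -> False.
  by move=> xu xc; have := r_ind _ _ _ xu xc.
pose Q := [set u : 'I_n | [exists c : 'I_m, r (inl u) (inr c)]].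
pose S := [set c : 'I_m | [exists u : 'I_n, r (inl u) (inr c)]].
have inQ u c : r (inl u) (inr c) -> u \in Q by move=> uc; rewrite inE; apply/existsP; exists c.
have inS u c : r (inl u) (inr c) -> c \in S by move=> uc; rewrite inE; apply/existsP; exists u.
have notQ u v : r (inl u) (inl v) -> u \notin Q.
  by move=> uv; rewrite inE; apply/existsP => -[c uc]; apply: rmix uv uc.
have notS c c' : r (inr c) (inr c') -> c \notin S.
  move=> cc; rewrite inE; apply/existsP => -[u]; rewrite r_sym => uc; exact: rmix uc cc.
have ind_nbhd x : #|[set c : 'I_m | r x (inr c)]| <= m %/ 2.
  apply: independent_cycle_card; first exact: ltnW.
  by move=> c c'; rewrite !inE => xc xc'; apply: (r_ind _ _ _ xc xc').
have cQ : #|~: Q| + #|Q| = n by rewrite addnC cardsC card_ord.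
have cS : #|~: S| = m - #|S| by have := cardsC S; rewrite card_ord; lia.
have sm : #|S| <= m by rewrite -[X in _ <= X]card_ord max_card.
rewrite card_rel_sum big_sumType /=.
under eq_bigr do rewrite big_sumType /=.
under [X in _ + X]eq_bigr do rewrite big_sumType /=.
(* The two mixed blocks of the sum agree by symmetry and give the term [2 * b]. *)
rewrite !big_split /= [X in _ + (X + _)]exchange_big /=.
under [X in _ + (X + _)]eq_bigr do under eq_bigr do rewrite r_sym.
rewrite addnA -[X in X + _]addnA addnn -mul2n -[in X in _ <= X]cQ.
apply: (@edge_count_leq m #|~: Q| #|Q| #|S| (m %/ 2)) => //.
- move=> /eqP; rewrite cards_eq0 => /eqP S0; apply/eqP; rewrite cards_eq0.
  apply/eqP/setP => u; rewrite !inE; apply/existsP => -[c /inS].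
  by rewrite S0 inE.
- apply: sum_rel_leq => [u uQ|u v /notQ]; last by rewrite in_setC.
  have -> : #|~: Q|.-1 = #|(~: Q) :\ u| by rewrite (cardsD1 u (~: Q)) uQ.
  apply/subset_leq_card/subsetP => v; rewrite in_set in_setD1 in_setC => uv.
  rewrite (@notQ v u) ?andbT 1?r_sym //.
  by apply: contraTneq uv => ->; rewrite r_irr.
- apply: sum_rel_leq => [u uQ|u c]; last exact: inQ.
  by apply/subset_leq_card/subsetP => c; rewrite in_set => /inS.
- by apply: sum_rel_leq => [u uQ|u c]; [exact: ind_nbhd | exact: inQ].
- by rewrite -cS; apply: sum_rel_leq => [c cS'|c c' /notS]; [exact: ind_nbhd | rewrite in_setC].
- rewrite -cS; apply: sum_rel_leq => [c ccS|c c' /notS]; last by rewrite in_setC.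
  have -> : #|~: S|.-1 = #|(~: S) :\ c| by rewrite (cardsD1 c (~: S)) ccS.
  apply/subset_leq_card/subsetP => c'; rewrite in_set in_setD1 in_setC => cc'.
  rewrite (@notS c' c) ?andbT 1?r_sym //.
  by apply: contraTneq cc' => ->; rewrite r_irr.
- move=> m2k sk k2.
  have cSk : #|~: S| = (m %/ 2).+1 by lia.
  have [c [c' [cD c'D cc']]] :
      exists c c', [/\ c \in ~: S, c' \in ~: S & cycle_rel c c'].
    case: (boolP [exists c in ~: S, exists c' in ~: S, cycle_rel c c']).
      by move=> /exists_inP[c cD /exists_inP[c' c'D cc']]; exists c, c'.
    (* Without an edge, these [k + 1] vertices would be an independent set of the cycle that is too
       large. *)
    move=> noedge; suff : #|~: S| <= m %/ 2 by rewrite cSk ltnn.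
    apply: independent_cycle_card => [|x y xD yD]; first exact: ltnW.
    apply: contra noedge => xy; apply/exists_inP; exists x => //.
    by apply/exists_inP; exists y.
  have := @sum_rel_leq_disjoint_nbhds _ (fun x y : 'I_m => r (inr x) (inr y)) (~: S) c c'.
  rewrite cSk; apply=> //.
  + by move=> x y /notS; rewrite in_setC.
  + by case/andP: cc'.
  + move=> x; rewrite ![r _ (inr x)]r_sym => cx; apply/negP => c'x.
    by have := r_ind _ _ _ cx c'x; rewrite /= cc'.
- by rewrite cQ.
Qed.

(** * An almost regular relation on the cycle *)

(* For i < j and k = m %/ 2: if m is even, i and j have opposite parities; if
   m is odd, i and j are joined by an arc of odd length < k, or by one of the
   k arcs from i to i + k with i < k when k is odd.  A difference d <= 0 gives
   false, because of the truncated subtraction. *)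
Definition cyc_opt_lt (m i j : nat) : bool :=
  let k := m %/ 2 in let d := j - i in
  if odd d then ~~ odd m || (d < k + (i < k)) else odd m && (k.+1 < d).

Definition cyc_opt m i j := cyc_opt_lt m i j || cyc_opt_lt m j i.

(* The neighbours of i are i - k + e + 2l modulo m for l < k, with e given by
   cyc_opt_shift; only (i, l) = (m - 1, 0) may fail to give a neighbour. *)
Definition cyc_opt_shift (m i : nat) : nat :=
  if ~~ odd (m %/ 2) then 1 else if odd m && (i < m %/ 2) then 2 else 0.

Lemma cyc_opt_shift_leq m i : cyc_opt_shift m i <= 2.
Proof. by rewrite /cyc_opt_shift; case: ifP => // _; case: ifP. Qed.

(** The summand [m] keeps the subtraction from truncating; for [i < m] and [l < m %/ 2] the value
    [j] is below [3 * m], so the conditionals reduce it modulo [m]. *)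
Definition cyc_opt_nbr (m i l : nat) : nat :=
  let j := i + m + 2 * l + cyc_opt_shift m i - m %/ 2 in
  if j < m then j else if j < 2 * m then j - m else j - 2 * m.

Lemma cyc_opt_nbr_lt m i l : 3 <= m -> i < m -> l < m %/ 2 -> cyc_opt_nbr m i l < m.
Proof.
rewrite /cyc_opt_nbr => m3 im lk.
have := cyc_opt_shift_leq m i; move: (cyc_opt_shift m i) => e e2.
case: ifP => // j1; case: ifP; lia.
Qed.

(** Before reduction the two values differ by twice the difference of [l] and [l'], which is less
    than [m]. *)
Lemma cyc_opt_nbr_inj m i l l' : 3 <= m -> i < m -> l < m %/ 2 -> l' < m %/ 2 ->
  cyc_opt_nbr m i l = cyc_opt_nbr m i l' -> l = l'.
Proof.
rewrite /cyc_opt_nbr => m3 im lk lk'.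
have := cyc_opt_shift_leq m i; move: (cyc_opt_shift m i) => e e2.
do ![case: ifP => ?]; lia.
Qed.

Lemma cyc_opt_nbr_spec m i l : 3 <= m -> i < m -> l < m %/ 2 ->
  let j := cyc_opt_nbr m i l in
  exists2 w, w <= 2 & j + w * m + m %/ 2 = i + m + 2 * l + cyc_opt_shift m i.
Proof.
rewrite /cyc_opt_nbr /=; have := cyc_opt_shift_leq m i.
move: (cyc_opt_shift m i) => e e2 m3 im lk.
by do ![case: ifP => ?]; [exists 0|exists 1|exists 2] => //; lia.
Qed.

(** Some exception is forced: for [m] and [m %/ 2] both odd, no graph on [m] vertices is regular of
    degree [m %/ 2]. *)
Lemma cyc_opt_nbrP m i l : 3 <= m -> i < m -> l < m %/ 2 -> ~~ ((i == m.-1) && (l == 0)) ->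
  cyc_opt m i (cyc_opt_nbr m i l).
Proof.
move=> m3 im lk il.
have := cyc_opt_nbr_lt m3 im lk; have [w w2] := cyc_opt_nbr_spec m3 im lk.
move: (cyc_opt_nbr m i l) => j; rewrite /cyc_opt /cyc_opt_lt /cyc_opt_shift.
have := odd_double_half m; have := odd_double_half (m %/ 2).
have -> : m./2 = m %/ 2 by lia.
move: (m %/ 2) lk => k lk; have := odd_double_half l.
have := odd_double_half i => Ei El Ek Em Ew jm.
move: w w2 Ew => [|[|[|//]]] _; rewrite ?mul0n ?mul1n;
  move: Ek Em; case: (odd k) => /=; case: (odd m) => /= Ek Em;
  do ![case: ifP => /= ?]; lia.
Qed.

(** Neighbours of [x] are spaced two apart on an arc of [2 * (m %/ 2) - 1] vertices, which leaves a
    gap of at least one vertex. *)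
Lemma cyc_opt_indep m x y z : 3 <= m -> x < m -> y < m -> z < m ->
  z = y.+1 \/ (y = m.-1 /\ z = 0) -> cyc_opt m x y -> cyc_opt m x z -> False.
Proof.
rewrite /cyc_opt /cyc_opt_lt => m3 xm ym zm.
have -> : odd m = (m != (m %/ 2).*2) by lia.
have : m = (m %/ 2).*2 + (m != (m %/ 2).*2) by lia.
move: (m %/ 2) => k.
case: (m =P k.*2) => /= _ Em; case=> [->|[-> ->]];
  do ![case: ifP => /= ?]; lia.
Qed.

Definition cyc_opt_rel m : rel 'I_m := fun i j => cyc_opt m i j.

Lemma nbhd_independent_cyc_opt m : 3 <= m ->
  @nbhd_independent (cycle_graph m) (@cyc_opt_rel m).
Proof.
move=> m3; split=> [x y|x|x y z xy xz]; first by rewrite /cyc_opt_rel /cyc_opt orbC.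
  by rewrite /cyc_opt_rel /cyc_opt /cyc_opt_lt subnn /= !andbF.
have step (u v : nat) : u < m -> v = u.+1 %% m -> v = u.+1 \/ u = m.-1 /\ v = 0.
  move=> um ->; have [Su|Su] := ltnP u.+1 m; first by left; rewrite modn_small.
  have -> : u.+1 = m by lia.
  by rewrite modnn; right; split; lia.
apply/negP => /andP[_ /orP[]/eqP E].
- exact: cyc_opt_indep m3 (ltn_ord x) (ltn_ord y) (ltn_ord z) (step _ _ (ltn_ord y) E) xy xz.
- exact: cyc_opt_indep m3 (ltn_ord x) (ltn_ord z) (ltn_ord y) (step _ _ (ltn_ord z) E) xz xy.
Qed.

Lemma cyc_opt_pairs m : 3 <= m ->
  m * (m %/ 2) <= (\sum_(x < m) \sum_(y < m) cyc_opt_rel x y).+1.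
Proof.
move=> m3.
have m0 : 0 < m by lia.
have k0 : 0 < m %/ 2 by lia.
have m1 : m.-1 < m by lia.
(* This is the only index whose image under [f] may fail to be a related pair. *)
pose bad : 'I_m * 'I_(m %/ 2) := (Ordinal m1, Ordinal k0).
pose f (p : 'I_m * 'I_(m %/ 2)) : 'I_m * 'I_m :=
  (p.1, Ordinal (cyc_opt_nbr_lt m3 (ltn_ord p.1) (ltn_ord p.2))).
have f_inj : injective f.
  move=> [i l] [i' l'] [<- E].
  by congr (_, _); apply/val_inj; apply: (cyc_opt_nbr_inj m3 (ltn_ord i)) E.
rewrite -card_rel_sum -[X in X * _]card_ord -[X in _ * X]card_ord -card_prod.
rewrite -cardsT (cardsD1 bad) inE add1n ltnS -(card_imset _ f_inj).
apply/subset_leq_card/subsetP => _ /imsetP[[i l] + ->].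
by rewrite !inE andbT /f /= => il; apply: cyc_opt_nbrP.
Qed.

(** * The two bounds on the independence number *)

Lemma mul_predn_bin2 n : n * n.-1 = 'C(n, 2).*2.
Proof.
rewrite bin2 -[LHS]odd_double_half oddM.
by case: n => //= n; case: odd.
Qed.

Lemma independence_number_geq m n : 3 <= m ->
  m * (m %/ 2) %/ 2 + 'C(n, 2) <= independence_number (two_token (gen_wheel n m)).
Proof.
move=> m3.
pose r : rel (gen_wheel n m) := fun x y => match x, y with
  | inl u, inl v => u != v
  | inr c, inr c' => cyc_opt_rel c c'
  | _, _ => false end.
have [c_sym c_irr c_ind] := nbhd_independent_cyc_opt m3.
have r_ok : nbhd_independent r.
  split=> [[u|c] [v|c'] //=|[u|c] //=|[u|c] [v|c'] [w|c''] //=]; rewrite ?eqxx //.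
  - by rewrite eq_sym.
  - exact: c_ind.
have := nbhd_independent_leq r_ok.
rewrite card_rel_sum big_sumType /=.
under eq_bigr do rewrite big_sumType /= [X in _ + X]big1 // addn0 sum_bool_card.
under [X in _ + X]eq_bigr do rewrite big_sumType /= big1 // add0n.
have := cyc_opt_pairs m3.
have -> : \sum_(u < n) #|[set v : 'I_n | u != v]| = n * n.-1.
  rewrite -[X in X * _]card_ord -sum_nat_const; apply: eq_bigr => u _.
  rewrite -[X in X.-1]card_ord -(cardsC1 u); apply: eq_card => v.
  by rewrite !inE eq_sym.
set t := \sum_(x < m) _; move: t (m * _) => t M.
(* The possibly missing ordered pair costs nothing: the independence number is an integer, and (M -
   1)/2 rounded up is M/2 rounded down. *)
rewrite mul_predn_bin2; move: ('C(n, 2)) => N; lia.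
Qed.

Lemma independence_number_leq m n : 3 <= m -> (m = 3 -> 3 <= n) ->
  independence_number (two_token (gen_wheel n m)) <= m * (m %/ 2) %/ 2 + 'C(n, 2).
Proof.
move=> m3 n3; have [r r_ok] := nbhd_independent_ex (gen_wheel n m).
have := gen_wheel_pairs_leq m3 n3 r_ok => + E; rewrite E.
rewrite mul_predn_bin2; move: ('C(n, 2)) (m * _) => N M; lia.
Qed.

(** * The exceptional cases *)

(** Joining one triangle vertex to all of E_n, and the other two to each other, gives [n + 1] edges
    with independent neighbourhoods. *)
Lemma independence_number_gen_wheel3_gt n :
  n < independence_number (two_token (gen_wheel n 3)).
Proof.
pose r : rel (gen_wheel n 3) := fun x y => match x, y with
  | inl _, inr c => c == ord0
  | inr c, inl _ => c == ord0
  | inr c, inr c' => (c != ord0) && (c' != ord0) && (c != c')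
  | _, _ => false end.
have r_ok : nbhd_independent r.
  split=> [[u|c] [v|c'] //=|[u|c] //=|[u|c] [v|c'] [w|c''] //=]; rewrite ?eqxx ?andbF //.
  - by rewrite [c' == c]eq_sym [(c' != _) && _]andbC.
  - by move=> /eqP -> /eqP ->; rewrite cycle_irrefl.
  - by move=> /eqP ->.
  - by move=> /andP[/andP[/negP c0 _] _] c0'.
  - by case: c c' c'' => [[|[|[|//]]] ?] [[|[|[|//]]] ?] [[|[|[|//]]] ?] //=.
have := nbhd_independent_leq r_ok.
rewrite card_rel_sum big_sumType /=.
under eq_bigr do rewrite big_sumType /=.
under [X in _ + X]eq_bigr do rewrite big_sumType /=.
rewrite !big_split /= !big_ord_recl !big_ord0 /=.
rewrite !sum_nat_const !card_ord /=.
lia.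
Qed.

Theorem theorem6 (m n : nat) (hm : 3 <= m) (hn : 1 <= n) :
  independence_number (two_token (gen_wheel n m)) =
    (m * (m %/ 2)) %/ 2 + 'C(n, 2)
  <-> (m, n) \notin [:: (3, 1); (3, 2)].
Proof.
rewrite !inE !xpair_eqE; split=> [E|mn]; last first.
  apply/eqP; rewrite eqn_leq independence_number_geq // andbT.
  by apply: independence_number_leq => // m3; move: mn; rewrite m3; lia.
(* In both excluded cases the formula evaluates to [n], which is too small. *)
by apply/negP => /orP[]/andP[/eqP m3 /eqP n12];
  move: (independence_number_gen_wheel3_gt n); rewrite -m3 E m3 n12.
Qed.
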